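(* In the following cases $\mathrm{mtrank}(m_1,m_2,m_3)>\mathrm{grank}(m_1,m_2,m_3)$: 1. $m_1=m_2=m\ge 2$ and $m_3=(m-1)^2+1$. 2. $m_1=m_2=4$ and $m_3\in\{11,12\}$.
   Context: For positive integers $m_1,m_2,m_3$ let $\mathbf{f}_k(\mathbf{x}_{1,1},\mathbf{x}_{1,2},\mathbf{x}_{1,3},\ldots,\mathbf{x}_{k,1},\mathbf{x}_{k,2},\mathbf{x}_{k,3})=\sum_{l=1}^k\mathbf{x}_{l,1}\otimes\mathbf{x}_{l,2}\otimes\mathbf{x}_{l,3}$, where $\mathbf{x}_{l,j}$ has $m_j$ coordinates. The maximal typical rank $\mathrm{mtrank}(m_1,m_2,m_3)$ is the minimal $k\in\mathbb{N}$ such that the closure (in the standard topology) of $\mathbf{f}_k((\mathbb{R}^{m_1}\times\mathbb{R}^{m_2}\times\mathbb{R}^{m_3})^k)$ equals $\mathbb{R}^{m_1\times m_2\times m_3}$. The generic rank $\mathrm{grank}(m_1,m_2,m_3)$ (over $\mathbb{C}$) is the smallest positive integer $k$ for which there exist vectors $\mathbf{x}_{l,j}\in\mathbb{C}^{m_j}$ ($j=1,2,3$, $l=1,\ldots,k$) such that the $k(m_1+m_2+m_3)$ tensors $\mathbf{e}_{i_1,1}\otimes\mathbf{x}_{l,2}\otimes\mathbf{x}_{l,3}$, $\mathbf{x}_{l,1}\otimes\mathbf{e}_{i_2,2}\otimes\mathbf{x}_{l,3}$, $\mathbf{x}_{l,1}\otimes\mathbf{x}_{l,2}\otimes\mathbf{e}_{i_3,3}$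 ($i_j=1,\ldots,m_j$, $l=1,\ldots,k$) span $\mathbb{C}^{m_1\times m_2\times m_3}$; here $\mathbf{e}_{1,j},\ldots,\mathbf{e}_{m_j,j}$ is the standard basis of $\mathbb{C}^{m_j}$. *)

(* Defs.v *)
From mathcomp Require Import all_boot all_order all_algebra.
From mathcomp Require Import all_classical all_reals topology normedtype.
From mathcomp.real_closed Require Import complex.
Set Implicit Arguments.
Unset Strict Implicit.
Unset Printing Implicit Defensive.
Import Order.TTheory GRing.Theory Num.Theory.
Import numFieldNormedType.Exports.
Local Open Scope classical_set_scope.
Local Open Scope ring_scope.

(* K^(m1 x m2 x m3), flattened along the first two modes so as to inherit both
   the vectType structure and the entrywise (standard) topology of matrices:
   the (i, j, k) coordinate of T is T (mxvec_index i j) k. *)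
Notation tensor K m1 m2 m3 := 'M[K]_(m1 * m2, m3).

Definition tens3 (K : fieldType) m1 m2 m3
    (x : 'rV[K]_m1) (y : 'rV[K]_m2) (z : 'rV[K]_m3) : tensor K m1 m2 m3 :=
  (mxvec (x^T *m y))^T *m z.

Lemma tens3E (K : fieldType) m1 m2 m3
    (x : 'rV[K]_m1) (y : 'rV[K]_m2) (z : 'rV[K]_m3) i j k :
  tens3 x y z (mxvec_index i j) k = x 0 i * y 0 j * z 0 k.
Proof. by rewrite mxE big_ord1 mxE mxvecE mxE big_ord1 mxE. Qed.

Definition sum_rank1 (K : fieldType) m1 m2 m3 k
    (x : 'I_k -> 'rV[K]_m1 * 'rV[K]_m2 * 'rV[K]_m3) : tensor K m1 m2 m3 :=
  \sum_(l < k) tens3 (x l).1.1 (x l).1.2 (x l).2.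

Definition tangent_tensors (K : fieldType) m1 m2 m3 k
    (x : 'I_k -> 'rV[K]_m1 * 'rV[K]_m2 * 'rV[K]_m3) : seq (tensor K m1 m2 m3) :=
  [seq tens3 (delta_mx 0 i) (x l).1.2 (x l).2 | l <- enum 'I_k, i <- enum 'I_m1]
  ++ [seq tens3 (x l).1.1 (delta_mx 0 i) (x l).2
     | l <- enum 'I_k, i <- enum 'I_m2]
  ++ [seq tens3 (x l).1.1 (x l).1.2 (delta_mx 0 i)
     | l <- enum 'I_k, i <- enum 'I_m3].

Definition mtrank_pred (R : realType) m1 m2 m3 (k : nat) : bool :=
  `[< closure (range (@sum_rank1 R m1 m2 m3 k)) = setT >].

Definition grank_pred (K : fieldType) m1 m2 m3 (k : nat) : bool :=
  `[< (0 < k)%N /\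
      exists x : 'I_k -> 'rV[K]_m1 * 'rV[K]_m2 * 'rV[K]_m3,
        <<tangent_tensors x>>%VS = fullv >].

Section Existence.
Variables (K : fieldType) (m1 m2 m3 : nat).

Lemma tensor_sum_delta (T : tensor K m1 m2 m3) :
  T = \sum_(t : 'I_m1 * 'I_m2 * 'I_m3)
        tens3 (T (mxvec_index t.1.1 t.1.2) t.2 *: delta_mx 0 t.1.1)
              (delta_mx 0 t.1.2) (delta_mx 0 t.2).
Proof.
apply/matrixP => p k; case/mxvec_indexP: p => i j.
rewrite summxE (bigD1 (i, j, k)) //= tens3E !mxE !eqxx !mulr1 big1 ?addr0 //.
move=> [[i' j'] k'] /= ne; rewrite tens3E !mxE !eqxx /=.
case: (eqVneq i i') ne => [<-|_ _]; last by rewrite !(mulr0, mul0r).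
case: (eqVneq j j') => [<-|_ _]; last by rewrite !(mulr0, mul0r).
by case: (eqVneq k k') => [<-|_ _]; rewrite ?eqxx //= mulr0.
Qed.

Lemma sum_rank1_surj (T : tensor K m1 m2 m3) :
  exists x : 'I_#|{: 'I_m1 * 'I_m2 * 'I_m3}| -> _, sum_rank1 x = T.
Proof.
exists (fun l => let t := enum_val l in
  (T (mxvec_index t.1.1 t.1.2) t.2 *: delta_mx 0 t.1.1,
   delta_mx 0 t.1.2, delta_mx 0 t.2)).
rewrite [RHS]tensor_sum_delta /sum_rank1 /=.
by rewrite [RHS](reindex _ (onW_bij _ (enum_val_bij _))).
Qed.

Lemma grank_exists : exists k, grank_pred K m1 m2 m3 k.
Proof.
pose I := ('I_m1 * 'I_m2 * 'I_m3)%type.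
exists #|{: I}|.+1; apply/asboolP; split => //.
pose e (t : I) : 'rV[K]_m1 * 'rV[K]_m2 * 'rV[K]_m3 :=
  (delta_mx 0 t.1.1, delta_mx 0 t.1.2, delta_mx 0 t.2).
exists (fun l => if unlift ord0 l is Some l' then e (enum_val l') else 0).
apply/eqP; rewrite eqEsubv subvf /=; apply/subvP => T _.
rewrite (tensor_sum_delta T); apply: memv_suml => -[[i j] k] _ /=.
have -> (a : K) : tens3 (a *: delta_mx 0 i) (delta_mx 0 j) (delta_mx 0 k)
    = a *: tens3 (delta_mx 0 i) (delta_mx 0 j) (delta_mx 0 k) :> tensor K _ _ _.
  by rewrite /tens3 linearZ -scalemxAl linearZ linearZ -scalemxAl.
apply/memvZ/memv_span; rewrite mem_cat; apply/orP; left.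
apply/allpairsP; exists (lift ord0 (enum_rank ((i, j, k) : I)), i).
by rewrite !mem_enum liftK enum_rankK.
Qed.

End Existence.

Lemma mtrank_exists (R : realType) m1 m2 m3 :
  exists k, mtrank_pred R m1 m2 m3 k.
Proof.
exists #|{: 'I_m1 * 'I_m2 * 'I_m3}|; apply/asboolP.
rewrite -subTset; apply: subset_trans (@subset_closure _ _) => T _.
by have [x <-] := sum_rank1_surj T; exists x.
Qed.

Definition mtrank (R : realType) m1 m2 m3 : nat :=
  ex_minn (mtrank_exists R m1 m2 m3).

Definition grank (K : fieldType) m1 m2 m3 : nat :=
  ex_minn (grank_exists K m1 m2 m3).

(* Main.v *)
Require Import Defs.
From mathcomp Require Import all_boot all_order all_algebra.
From mathcomp Require Import all_classical all_reals topology normedtype.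
From mathcomp.real_closed Require Import complex.
From mathcomp Require Import ring lra zify.

(** The generic rank and the maximal typical rank are separated by the number
[m3] itself: the former is at most [m3], the latter is larger.

_Real side._ View a tensor as the list of its [m3] slices, matrices of size
m1 x m2.  If a tensor is a sum of at most [m3] rank one tensors
[x_l (x) y_l (x) z_l], then some nonzero combination of its slices has rank at
most one: choose the coefficients orthogonal to all [z_l] but one, which leaves
at least one degree of freedom ([slice_combination_rank1]).  Hence, to see that
such sums are not dense, it suffices to find linearly independent slices
spanning a space without real matrices of rank one; the compactness of spheres
shows that this property is stable under small perturbations
([not_mtrank_of_nonsingular]).  A space of real matrices without rank one
elements is the annihilator of a nonsingular bilinear map, that is a map
[f : R^m1 x R^m2 -> R^n] such that [f x y = 0] forces [x = 0] or [y = 0]; it has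
dimension at least [m1 * m2 - n].  Two such maps are used.

- For every [m >= 2], a map to [R^(2m-2)] whose first coordinate is the inner
  product and whose [2m-3] others are the sums of the Pluecker coordinates
  [x_i y_j - x_j y_i], [i < j], over the antidiagonals [i + j = l]
  ([skew_forms_nonsingular]).  If the others vanish, then comparing leading
  terms shows that [x] and [y] are proportional, and then the inner product
  can only vanish when one of them does.  Since
  [m^2 - (2m-2) = (m-1)^2 + 1], this settles the first family.
- For [m = 4], the quaternion product to [R^4]; it gives a space of dimension
  12, hence also one of dimension 11 ([quaternion_forms_nonsingular]).

_Complex side._ Take [x_{l,3} = e_l].  The tangent tensors span everything as
soon as, for every [l], the matrices [x_l (x) y_l], together with the tangent
space [x_l (x) C^m + C^m (x) y_l] at one of them, span all matrices.  Write
[m = n + 1] and identify [C^m] with polynomials of degree at most [n].  Fix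
[2n] distinct points split into two halves [a] and [b]; the pairs
[(x_l, y_l)] are two complementary factors of degree [n] of
[r = prod (X - a_i) (X - b_j)]: the one given by the two halves, and those
obtained from it by exchanging one [a_i] with one [b_j].  They number
[n^2 + 1], and are repeated if [m3] is larger.  The differences between the
first and the others are, up to scalars, [(X - Y) L_i(X) M_j(Y)] where the [L_i]
and [M_j] are the Lagrange bases at the [a]'s and the [b]'s, so they span the
whole kernel of the multiplication [u (x) v |-> u v].  Modulo this kernel only
the product [u v] matters, and since the two factors [p, q] are coprime, every
polynomial of degree at most [2n] is of the form [p u + v q], the product of a
tangent vector [p (x) u + v (x) q]
([balanced_of_root_splits], [balanced_eq0], [grank_pred_of_root_splits]). *)

Set Implicit Arguments.
Unset Strict Implicit.
Unset Printing Implicit Defensive.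
Import Order.TTheory GRing.Theory Num.Theory.
Import numFieldNormedType.Exports.
Local Open Scope classical_set_scope.
Local Open Scope ring_scope.

(** * Nonsingular bilinear maps *)

(** The components [b l] are the bilinear forms of a nonsingular bilinear map to
[K^n], written in coordinates. *)
Definition nonsingular (K : fieldType) m1 m2 n (b : 'I_n -> 'M[K]_(m1, m2)) :=
  forall (x : 'rV[K]_m1) (y : 'rV[K]_m2),
    (forall l, x *m b l *m y^T = 0) -> x = 0 \/ y = 0.

Section Skew.
Variables (K : realFieldType) (m : nat).

(** For vectors [x], [y] this form is the sum of the Pluecker coordinates
[x_i y_j - x_j y_i] over [i < j] with [i + j = l]. *)
Definition antidiag_skew (l : nat) : 'M[K]_m :=
  \matrix_(i, j) (((i + j)%N == l)%:R * ((i < j)%N%:R - (j < i)%N%:R)).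

(** There is no pair [i < j] with [i + j = 0], so the index 0 is free to carry the
inner product. *)
Definition skew_forms n (l : 'I_n) : 'M[K]_m :=
  if val l is 0%N then 1%:M else antidiag_skew l.

Lemma bilinearE (b : 'M[K]_m) (x y : 'rV_m) :
  (x *m b *m y^T) 0 0 = \sum_i \sum_j x 0 i * b i j * y 0 j.
Proof.
rewrite mxE exchange_big; apply: eq_bigr => j _.
by rewrite !mxE big_distrl.
Qed.

Lemma antidiag_skew_xx l (x : 'rV_m) : x *m antidiag_skew l *m x^T = 0.
Proof.
have skew : (antidiag_skew l)^T = - antidiag_skew l.
  by apply/matrixP => i j; rewrite !mxE addnC -mulrN opprB.
have : (x *m antidiag_skew l *m x^T)^T = - (x *m antidiag_skew l *m x^T).
  by rewrite !trmx_mul trmxK skew mulNmx mulmxN mulmxA.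
move=> /matrixP/(_ 0 0); rewrite [LHS]mxE [RHS]mxE => zz.
by apply/matrixP => i j; rewrite !ord1 [RHS]mxE; lra.
Qed.

Definition top_index (x : 'rV[K]_m) (i : 'I_m) :=
  x 0 i != 0 /\ forall j : 'I_m, (i < j)%N -> x 0 j = 0.

Lemma top_indexP (x : 'rV[K]_m) : x != 0 -> exists i, top_index x i.
Proof.
move=> x0; have [i0 xi0] : exists i, x 0 i != 0.
  apply/existsP; apply: contraNT x0 => /existsPn x0.
  by apply/eqP/rowP => i; rewrite mxE; apply/eqP; have := x0 i; rewrite negbK.
case: (@arg_maxnP _ i0 (fun i => x 0 i != 0) val xi0) => i xi imax.
exists i; split => // j; apply: contraTeq => /imax.
by rewrite -leqNgt.
Qed.

(** Leading terms do not cancel: among the index pairs with sum [i + j], only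
[(i, j)] avoids the zeros of [x] beyond [i] and those of [y] beyond [j]. *)
Lemma antidiag_skew_top (x y : 'rV_m) (i j : 'I_m) :
  top_index x i -> top_index y j -> i != j ->
  x *m antidiag_skew (i + j) *m y^T != 0.
Proof.
move=> [xi xtop] [yj ytop] ij; apply/eqP => /matrixP/(_ 0 0).
rewrite bilinearE [RHS]mxE (bigD1 i) //= (bigD1 j) //= !big1 ?addr0.
- rewrite mxE eqxx mul1r => /eqP; rewrite !mulf_eq0 (negPf xi) (negPf yj) orbF /=.
  apply/negP; move: ij; rewrite -val_eqE /=.
  by case: ltngtP => //= _ _; rewrite ?subr0 ?sub0r ?oppr_eq0 oner_eq0.
- move=> i' ne; rewrite big1 // => j' _; rewrite mxE.
  case: eqP => [e|]; last by rewrite !(mul0r, mulr0).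
  have [/xtop->|] := ltnP i i'; first by rewrite !mul0r.
  rewrite leq_eqVlt val_eqE (negPf ne) /= => lt.
  by rewrite (ytop j') ?mulr0 //; lia.
- move=> j' ne; rewrite mxE eqn_add2l val_eqE (negPf ne).
  by rewrite !(mul0r, mulr0).
Qed.

(** The skew forms do not change when a multiple of [y] is subtracted from [x], so
the leading terms of [x] and [y] may be assumed to sit at different places; the
previous lemma then says that nothing remains of [x].  Once [x] is a multiple
of [y], the inner product decides.  The relevant sums of two distinct
indices below [m] range from 1 to [2m - 3], which gives [2m - 2] forms. *)
Lemma skew_forms_nonsingular :
  (2 <= m)%N -> nonsingular (@skew_forms (2 * m - 2)).
Proof.
move=> m2 x y nul; have [->|y0] := eqVneq y 0; [by right|left].
have [j ytop] := top_indexP y0; have [yj _] := ytop.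
pose a := x 0 j / y 0 j; pose x' := x - a *: y.
have x'j : x' 0 j = 0 by rewrite !mxE divfK // subrr.
have x'0 : x' = 0.
  apply/eqP; apply: contraT => /top_indexP[i x'top].
  have ij : i != j by apply: contraNneq x'top.1 => ->; rewrite x'j.
  have lt_l : (i + j < 2 * m - 2)%N.
    by move: ij; rewrite -val_eqE /=; have := ltn_ord i; have := ltn_ord j; lia.
  have := antidiag_skew_top x'top ytop ij.
  have := nul (Ordinal lt_l); rewrite /skew_forms /=.
  case e : (i + j)%N => [|l]; first by move: ij; rewrite -val_eqE /=; lia.
  rewrite -e mulmxBl mulmxBl -!scalemxAl antidiag_skew_xx scaler0 subr0 => ->.
  by rewrite eqxx.
have xE : x = a *: y by apply/eqP; rewrite -subr_eq0 -/x' x'0.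
have lt0 : (0 < 2 * m - 2)%N by lia.
have /matrixP/(_ 0 0) := nul (Ordinal lt0).
rewrite /skew_forms /= mulmx1 xE -scalemxAl !mxE => /eqP.
rewrite mulf_eq0 => /orP[/eqP->|]; first by rewrite scale0r.
rewrite psumr_eq0 => [|k _]; last by rewrite mxE -expr2 sqr_ge0.
by move=> /allP/(_ j (mem_index_enum _)); rewrite mxE mulf_eq0 (negPf yj).
Qed.

End Skew.

Section Quaternion.
Variable K : realFieldType.

(** Row [l] of the list holds the [l]-th coordinate, in the basis 1, i, j, k, of the
product of two quaternions. *)
Definition quaternion_forms (l : 'I_4) : 'M[K]_4 :=
  \matrix_(i, j) nth 0 (nth [::] (nth [::]
   [:: [:: [:: 1; 0; 0; 0]; [:: 0; -1; 0; 0]; [:: 0; 0; -1; 0]; [:: 0; 0; 0; -1]];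
       [:: [:: 0; 1; 0; 0]; [:: 1; 0; 0; 0]; [:: 0; 0; 0; 1]; [:: 0; 0; -1; 0]];
       [:: [:: 0; 0; 1; 0]; [:: 0; 0; 0; -1]; [:: 1; 0; 0; 0]; [:: 0; 1; 0; 0]];
       [:: [:: 0; 0; 0; 1]; [:: 0; 0; 1; 0]; [:: 0; -1; 0; 0]; [:: 1; 0; 0; 0]]]
   l) i) j.

(** The norm of quaternions is multiplicative (the four squares identity). *)
Lemma quaternion_forms_nonsingular : nonsingular quaternion_forms.
Proof.
move=> x y nul.
have form (l : 'I_4) := etrans (esym (bilinearE (quaternion_forms l) x y))
  (congr1 (fun M : 'M_1 => M 0 0) (nul l)).
have rowE (z : 'rV[K]_4) : \sum_i z 0 i ^+ 2 = 0 -> z = 0.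
  move=> /eqP; rewrite psumr_eq0 => [|i _]; last exact: sqr_ge0.
  move=> /allP z0; apply/rowP => i; rewrite mxE; apply/eqP.
  by have := z0 i (mem_index_enum _); rewrite /= sqrf_eq0.
have : (\sum_i x 0 i ^+ 2) * (\sum_i y 0 i ^+ 2) = 0.
  transitivity
    (\sum_l (\sum_i \sum_j x 0 i * quaternion_forms l i j * y 0 j) ^+ 2).
    by rewrite !big_ord_recl !big_ord0 !mxE /=; ring.
  by rewrite big1 // => l _; rewrite form mxE expr0n.
by move=> /eqP; rewrite mulf_eq0 => /orP[]/eqP/rowE; [left|right].
Qed.

End Quaternion.

(** * An open set of real tensors of large rank *)

Lemma mxvec_dot (K : fieldType) m1 m2
    (x : 'rV[K]_m1) (y : 'rV[K]_m2) (M : 'M_(m1, m2)) :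
  mxvec (x^T *m y) *m (mxvec M)^T = x *m M *m y^T.
Proof.
apply/matrixP => i0 j0; rewrite !ord1 !mxE.
transitivity (\sum_j \sum_i x 0 i * M i j * y 0 j).
  rewrite exchange_big pair_bigA (reindex _ (curry_mxvec_bij m1 m2)) /=.
  apply: eq_bigr => -[i j] _ /=.
  by rewrite [(mxvec M)^T _ _]mxE !mxvecE mxE big_ord1 mxE mulrAC.
by apply: eq_bigr => j _; rewrite !mxE big_distrl.
Qed.

(** The vector [c] is orthogonal to the third factors of all terms but one, at most
[m3 - 1] linear conditions; combining the slices with the coefficients [c]
then leaves a multiple of the remaining rank one matrix. *)
Lemma slice_combination_rank1 (K : fieldType) m1 m2 m3 k
    (x : 'I_k -> 'rV[K]_m1.+1 * 'rV[K]_m2.+1 * 'rV[K]_m3) :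
  (0 < m3)%N -> (k <= m3)%N ->
  exists (c : 'rV[K]_m3) (u : 'rV[K]_m1.+1) (v : 'rV[K]_m2.+1),
    c != 0 /\ c *m (sum_rank1 x)^T = mxvec (u^T *m v).
Proof.
case: m3 x => // m3 x _.
have sumE c : c *m (sum_rank1 x)^T =
    \sum_(l < k) (c *m (x l).2^T) *m (mxvec ((x l).1.1^T *m (x l).1.2)).
  rewrite /sum_rank1 linear_sum mulmx_sumr; apply: eq_bigr => l _.
  by rewrite /tens3 /= trmx_mul trmxK mulmxA.
case: k x sumE => [|k] x sumE lek.
  exists (const_mx 1), 0, 0; split.
    by apply/eqP => /rowP/(_ ord0); rewrite !mxE; apply/eqP/oner_neq0.
  by rewrite sumE big_ord0 mulmx0 linear0.
pose Z := \matrix_(i < k, s < m3.+1) (x (lift ord0 i)).2 0 s.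
have : kermx Z^T != 0.
  rewrite -mxrank_eq0 mxrank_ker -lt0n subn_gt0 mxrank_tr.
  by apply: leq_ltn_trans (rank_leq_row _) _.
case/rowV0Pn => c /sub_kermxP cZ c0.
exists c, ((c *m (x ord0).2^T) 0 0 *: (x ord0).1.1), (x ord0).1.2; split => //.
rewrite sumE big_ord_recl /= big1 ?addr0 => [|i _].
  rewrite [c *m _]mx11_scalar mul_scalar_mx linearZ /= -scalemxAl linearZ /=.
  by rewrite [X in _ = X *: _]mxE eqxx mulr1n.
suff -> : c *m (x (lift ord0 i)).2^T = 0 by rewrite mul0mx.
apply/matrixP => a b; rewrite !ord1.
transitivity ((c *m Z^T) 0 i); last by rewrite cZ !mxE.
by rewrite !mxE; apply: eq_bigr => s _; rewrite !mxE.
Qed.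

Section RealTensors.
Variable R : realType.

Lemma compact_sphere n : compact [set v : 'rV[R]_n | `|v| = 1].
Proof.
apply: bounded_closed_compact.
  by exists 1; split => // M M1 v /= ->; exact: ltW.
rewrite (_ : mkset _ = Num.norm @^-1` [set 1 : R]) //.
apply: closed_comp; last exact: closed_eq.
by move=> v _; apply: norm_continuous.
Qed.

Lemma unit_direction n (x : 'rV[R]_n.+1) :
  exists a (u : 'rV[R]_n.+1), `|u| = 1 /\ x = a *: u.
Proof.
suff nz (y : 'rV[R]_n.+1) :
    y != 0 -> `| `|y|^-1 *: y| = 1 /\ y = `|y| *: (`|y|^-1 *: y).
  have [->|/nz[? ?]] := eqVneq x 0; last by eexists; eexists; split; eassumption.
  have /nz[? _] : const_mx 1 != 0 :> 'rV[R]_n.+1.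
    by apply/eqP => /rowP/(_ ord0); rewrite !mxE; apply/eqP/oner_neq0.
  by exists 0; eexists; split; first eassumption; rewrite scale0r.
move=> y0; rewrite scalerA mulfV ?normr_eq0// scale1r normrZ normfV normr_id.
by rewrite mulVf // normr_eq0.
Qed.

(** The previous relation between slices in a form whose parameters range over a
compact set.  The vector [w] packs the coefficient of the rank one matrix
(first entry) with those of the slices; as the two are normalized together,
slices of any size are covered. *)
Lemma unit_parameters_of_rank_le m1 m2 m3 k
    (x : 'I_k -> 'rV[R]_m1.+1 * 'rV[R]_m2.+1 * 'rV[R]_m3) :
    (0 < m3)%N -> (k <= m3)%N ->
  exists (u : 'rV[R]_m1.+1) (v : 'rV[R]_m2.+1) (w : 'rV[R]_(1 + m3)),
    [/\ `|u| = 1, `|v| = 1, `|w| = 1 &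
        rsubmx w *m (sum_rank1 x)^T = lsubmx w *m mxvec (u^T *m v)].
Proof.
move=> m30 km3.
have [c [u [v [c0]]]] := slice_combination_rank1 x m30 km3.
have [a [u' [u1 ->]]] := unit_direction u.
have [b [v' [v1 ->]]] := unit_direction v.
have -> : mxvec ((a *: u')^T *m (b *: v')) = (a * b) *: mxvec (u'^T *m v').
  apply/rowP => p; case/mxvec_indexP: p => i j.
  by rewrite [RHS]mxE !mxvecE !mxE !big_ord1 !mxE mulrACA.
move=> cT.
have [d [w' [w1 wE]]] := @unit_direction m3 (row_mx (a * b)%:M c).
have d0 : d != 0.
  apply: contraNneq c0 => d0.
  have : row_mx (a * b)%:M c == 0 by apply/eqP/(etrans wE); rewrite d0 scale0r.
  by rewrite row_mx_eq0 => /andP[].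
exists u', v', w'; split => //.
apply: (scalerI d0); rewrite !scalemxAl -!linearZ /= -wE.
by rewrite row_mxKl row_mxKr cT mul_scalar_mx.
Qed.

Lemma cvg_mulmx_entry T (F : set_system T) (FF : Filter F) m n p
    (f : T -> 'M[R]_(m, n)) (g : T -> 'M[R]_(n, p))
    (a : 'M[R]_(m, n)) (b : 'M[R]_(n, p)) i j :
  (forall k, f t i k @[t --> F] --> a i k) ->
  (forall k, g t k j @[t --> F] --> b k j) ->
  (f t *m g t) i j @[t --> F] --> (a *m b) i j.
Proof.
move=> fa gb; rewrite mxE.
under eq_fun do rewrite mxE.
apply: cvg_big => [|k _]; first exact: add_continuous.
exact: cvgM.
Qed.

(** The tensor [A^T], whose slices are linearly independent and annihilated by the
forms [b], admits no relation of the form given by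
[unit_parameters_of_rank_le]: applying the forms kills the slices, hence the
rank one term, and then independence kills the coefficients of the slices.
Absence of a solution in a compact set is an open condition on the tensor, so
[A^T] is not in the closure. *)
Lemma not_mtrank_of_nonsingular m1 m2 m3 n (b : 'I_n -> 'M[R]_(m1.+1, m2.+1)) k :
  nonsingular b -> (0 < m3)%N -> (m3 + n <= m1.+1 * m2.+1)%N -> (k <= m3)%N ->
  ~ mtrank_pred R m1.+1 m2.+1 m3 k.
Proof.
move=> nsb m30 le_n km3.
pose B : 'M[R]_(m1.+1 * m2.+1, n) := \matrix_(p, l) mxvec (b l) 0 p.
have BE (u : 'rV[R]_m1.+1) (v : 'rV[R]_m2.+1) :
    mxvec (u^T *m v) *m B = 0 -> u = 0 \/ v = 0.
  move=> uvB; apply: nsb => l; rewrite -mxvec_dot.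
  apply/matrixP => i j; rewrite !ord1.
  transitivity ((mxvec (u^T *m v) *m B) 0 l); last by rewrite uvB !mxE.
  by rewrite !mxE; apply: eq_bigr => p _; rewrite !mxE.
have [A AB rA] : exists2 A : 'M[R]_(m3, m1.+1 * m2.+1), A *m B = 0 & row_free A.
  have rk : (m3 <= \rank (kermx B))%N.
    rewrite mxrank_ker (leq_trans _ (leq_sub2l _ (rank_leq_col _))) //.
    by rewrite leq_subRL ?(leq_trans _ le_n) ?leq_addl // addnC.
  exists (pid_mx m3 *m row_base (kermx B)).
    rewrite -mulmxA; have -> : row_base (kermx B) *m B = 0.
      by apply/sub_kermxP; rewrite eq_row_base.
    by rewrite mulmx0.
  by rewrite /row_free mxrankMfree ?row_base_free // rank_pid_mx.
apply/negP/asboolPn => /seteqP[_ /(_ A^T I)].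
pose K := [set u : 'rV[R]_m1.+1 | `|u| = 1] `*`
   [set v : 'rV[R]_m2.+1 | `|v| = 1] `*` [set w : 'rV[R]_(1 + m3) | `|w| = 1].
pose g (T : tensor R m1.+1 m2.+1 m3)
    (q : 'rV[R]_m1.+1 * 'rV[R]_m2.+1 * 'rV[R]_(1 + m3)) :=
   rsubmx q.2 *m T^T - lsubmx q.2 *m mxvec (q.1.1^T *m q.1.2).
have K_compact : compact K.
  by apply: compact_setX; [apply: compact_setX|]; exact: compact_sphere.
have gA q : K q -> g A^T q != 0.
  move=> [[/= u1 v1] w1]; apply/eqP => /eqP; rewrite /g trmxK subr_eq0 => /eqP e.
  have /eqP := congr1 (mulmx^~ B) e; rewrite -mulmxA AB mulmx0 -mulmxA eq_sym.
  rewrite [lsubmx _]mx11_scalar mul_scalar_mx scaler_eq0 => /orP[/eqP l0|/eqP/BE].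
    move: e; rewrite [lsubmx _]mx11_scalar l0 mul_scalar_mx scale0r => /eqP.
    rewrite mulmx_free_eq0 // => /eqP r0; move: w1.
    rewrite -[q.2]hsubmxK r0 [lsubmx _]mx11_scalar l0 raddf0 row_mx0 normr0.
    by move/eqP; rewrite eq_sym oner_eq0.
  by case=> z0; [move: u1|move: v1]; rewrite z0 normr0 => /eqP;
    rewrite eq_sym oner_eq0.
have /compact_near_coveringP/(_ _ (nbhs A^T) (fun T q => g T q != 0)) := K_compact.
move=> nearK near_range.
have /near_range [_ [[x _ <-] /=]] : nbhs A^T [set T | forall q, K q -> g T q != 0].
  apply: nearK => q /gA gq.
  have [j gj] : exists j, g A^T q 0 j != 0.
    apply/existsP; apply: contraNT gq => /existsPn gq.
    apply/eqP/rowP => j; rewrite [RHS]mxE; apply/eqP.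
    by have := gq j; rewrite negbK.
  suff /cvgr_neq0/(_ gj) :
      (fun z : _ * _ => g z.2 z.1 0 j) @ (q, A^T) --> g A^T q 0 j.
    by apply: filterS => z; apply: contraNneq => ->; rewrite mxE.
  pose F := filter_prod (nbhs q) (nbhs A^T).
  have FF : Filter F by exact: filter_prod_filter.
  have entry m p (f : _ -> 'M[R]_(m, p)) (a : 'M[R]_(m, p)) i l :
      f @ F --> a -> (fun z => f z i l) @ F --> a i l.
    move=> fa.
    have := @continuous_cvg _ _ _ F FF f (fun M : 'M[R]_(m, p) => M i l) a
      (@coord_continuous R m p i l a).
    exact.
  have q1 : (fun z => z.1.1.1) @ F --> q.1.1.
    by apply: cvg_comp; [apply: cvg_comp|]; exact: cvg_fst.
  have q2 : (fun z => z.1.1.2) @ F --> q.1.2.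
    by apply: cvg_comp; [apply: cvg_comp; exact: cvg_fst|]; exact: cvg_snd.
  have q3 : (fun z => z.1.2) @ F --> q.2.
    by apply: cvg_comp; [exact: cvg_fst|exact: cvg_snd].
  have AT : (fun z => z.2) @ F --> A^T by exact: cvg_snd.
  rewrite /g [X in _ --> X]mxE [X in _ --> _ + X]mxE.
  under eq_fun do rewrite mxE [X in _ + X]mxE.
  apply: cvgB; apply: cvg_mulmx_entry => k'.
  - by rewrite mxE; under eq_fun do rewrite mxE; exact: entry.
  - by rewrite mxE; under eq_fun do rewrite mxE; exact: entry.
  - by rewrite mxE; under eq_fun do rewrite mxE; exact: entry.
  - case/mxvec_indexP: j k' {gj} => i j k'; rewrite ord1 mxvecE.
    under eq_fun do rewrite mxvecE.
    apply: cvg_mulmx_entry => l; last exact: entry.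
    by rewrite mxE; under eq_fun do rewrite mxE; exact: entry.
have [u [v [w [u1 v1 w1 e]]]] := unit_parameters_of_rank_le x m30 km3.
by move=> /(_ (u, v, w)); rewrite /g /= e subrr eqxx => /(_ _)/negP; apply.
Qed.

End RealTensors.

(** * Generic rank from factorizations of a polynomial *)

Lemma linear_sumZ (K : fieldType) (U Z : lmodType K) (f : U -> Z) : linear f ->
  forall (I : Type) (r : seq I) (c : I -> K) (u : I -> U),
  f (\sum_(i <- r) c i *: u i) = \sum_(i <- r) c i *: f (u i).
Proof.
move=> lf I r c u; elim: r => [|i r IH].
  rewrite !big_nil; have := lf (-1) 0 0.
  by rewrite scaler0 addr0 scaleN1r addNr.
by rewrite !big_cons lf IH.
Qed.

Lemma sum_coefZ (K : fieldType) n (p : {poly K}) : (size p <= n)%N ->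
  p = \sum_(i < n) p`_i *: 'X^i.
Proof. by move=> sp; rewrite -[LHS](take_poly_id sp) /take_poly poly_def. Qed.

(** In the Bezout relation for [h], the coefficient of [q] can be reduced modulo
[p]; the degree of the other coefficient is then bounded as well. *)
Lemma coprimep_decomposition (K : fieldType) n (p q h : {poly K}) :
  coprimep p q -> size p = n.+1 -> size q = n.+1 -> (size h <= 2 * n + 1)%N ->
  exists u v : {poly K},
    [/\ (size u <= n.+1)%N, (size v <= n.+1)%N & h = p * u + v * q].
Proof.
move=> /Bezout_eq1_coprimepP[[u0 v0] /= bez] sp sq sh.
have p0 : p != 0 by rewrite -size_poly_gt0 sp.
pose v : {poly K} := (h * v0) %% p.
pose u : {poly K} := h * u0 + ((h * v0) %/ p) * q.
have hE : h = p * u + v * q.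
  rewrite -[LHS]mulr1 -bez /u mulrDr mulrDr !mulrA.
  by rewrite {1}[h * v0](divp_eq _ p) /v; ring.
have sv : (size v < n.+1)%N by rewrite -sp ltn_modp.
clearbody u v.
exists u, v; split => //; last exact: ltnW.
have [->|u0'] := eqVneq u 0; first by rewrite size_poly0.
have : (size (p * u)%R <= 2 * n + 1)%N.
  rewrite (_ : p * u = h - v * q); last by rewrite hE addrK.
  rewrite (leq_trans (size_polyD _ _)) // geq_max sh size_polyN.
  rewrite (leq_trans (size_polyMleq _ _)) // sq addnS /=.
  by rewrite (leq_trans (leq_add (ltnSE sv) (leqnn n))) //; lia.
by rewrite size_mul // sp addSn mul2n -addnn -addnA leq_add2l addn1.
Qed.

Lemma coprimep_prod_XsubC (K : fieldType) (I J : finType)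
    (P : pred I) (Q : pred J) (f : I -> K) (g : J -> K) :
  (forall i j, f i != g j) ->
  coprimep (\prod_(i | P i) ('X - (f i)%:P)) (\prod_(j | Q j) ('X - (g j)%:P)).
Proof.
move=> fg; apply: (big_ind (fun p => coprimep p _)) => [|p q|i _].
- exact: coprime1p.
- by rewrite coprimepMl => -> ->.
apply: (big_ind (fun q => coprimep _ q)) => [|p q|j _].
- exact: coprimep1.
- by rewrite coprimepMr => -> ->.
by rewrite coprimep_XsubC root_XsubC eq_sym fg.
Qed.

Section RootSplits.
Variables (K : fieldType) (n : nat).

(** The Lagrange basis at the points [x_0, ..., x_(n-1)], up to scalars. *)
Definition punctured_nodal (x : nat -> K) (i : 'I_n) :=
  \prod_(j < n | j != i) ('X - (x j)%:P).

Lemma punctured_nodal_gen x (u : {poly K}) : injective x -> (size u <= n)%N ->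
  exists c : 'I_n -> K, u = \sum_i c i *: punctured_nodal x i.
Proof.
move=> x_inj su; case: (posnP n) => [n0|n_gt0].
  exists (fun=> 0); rewrite big1 => [|i _]; last by rewrite scale0r.
  by apply/eqP; rewrite -size_poly_leq0 -n0.
exists (fun i : 'I_n => u.[x i] * (punctured_nodal x i).[x i]^-1).
rewrite [LHS](lagrange_gen n_gt0 x_inj su); apply: eq_bigr => i _.
by rewrite lagrangeE //= mulrA -polyCM mul_polyC.
Qed.

Variables a b : nat -> K.
Hypotheses (a_inj : injective a) (b_inj : injective b).
Hypothesis ab : forall i j, a i != b j.

(** Splittings of [prod_i (X - a_i) (X - b_i)] into two factors of degree [n]: [None]
is the one given by the two families of roots, and [Some (i, j)] is obtained
from it by exchanging [a_i] and [b_j]. *)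
Definition root_split (t : option ('I_n * 'I_n)) : {poly K} * {poly K} :=
  if t is Some (i, j) then
    (('X - (b j)%:P) * punctured_nodal a i, ('X - (a i)%:P) * punctured_nodal b j)
  else (\prod_(i < n) ('X - (a i)%:P), \prod_(j < n) ('X - (b j)%:P)).

Lemma nodalE (x : nat -> K) (i : 'I_n) :
  \prod_(j < n) ('X - (x j)%:P) = ('X - (x i)%:P) * punctured_nodal x i.
Proof. by rewrite (bigD1 i). Qed.

Lemma size_punctured_nodal (x : nat -> K) i : size (punctured_nodal x i) = n.
Proof.
have := size_prod_XsubC (index_enum 'I_n) (fun j => x (val j)).
rewrite (nodalE x i) size_Mmonic ?monic_prod_XsubC ?polyXsubC_eq0 // size_XsubC /=.
by rewrite [index_enum _]unlock -enumT size_enum_ord => -[].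
Qed.

Lemma size_root_split t :
  size (root_split t).1 = n.+1 /\ size (root_split t).2 = n.+1.
Proof.
case: t => [[i j]|] /=.
  rewrite !size_Mmonic ?monic_prod_XsubC ?polyXsubC_eq0 //.
  by rewrite !size_XsubC !size_punctured_nodal.
by rewrite !size_prod_XsubC [index_enum _]unlock -enumT size_enum_ord.
Qed.

Lemma coprime_root_split t : coprimep (root_split t).1 (root_split t).2.
Proof.
case: t => [[i j]|] /=; last exact: coprimep_prod_XsubC.
have root_prod (x : nat -> K) c (l : 'I_n) :
    (forall k : 'I_n, k != l -> x k != c) -> ~~ root (punctured_nodal x l) c.
  move=> xc; rewrite /root horner_prod; apply/prodf_neq0 => k /xc.
  by rewrite hornerXsubC subr_eq0 eq_sym.
rewrite coprimepMl !coprimepMr coprimep_XsubC root_XsubC ab.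
rewrite coprimep_sym coprimep_XsubC root_prod => [|k];
  last by rewrite (inj_eq b_inj).
rewrite coprimep_XsubC root_prod => [|k];
  last by rewrite (inj_eq a_inj).
exact: coprimep_prod_XsubC.
Qed.

End RootSplits.

Section Balanced.
Variables (K : fieldType) (Z : lmodType K) (n : nat).
Variable beta : {poly K} -> {poly K} -> Z.
Hypothesis linl : forall v, linear (beta^~ v).
Hypothesis linr : forall u, linear (beta u).

Let betaZl a (u v : {poly K}) : beta (a *: u) v = a *: beta u v.
Proof.
have := linear_sumZ (linl v) [:: tt] (fun=> a) (fun=> u).
by rewrite !big_seq1.
Qed.
Let betaZr a (u v : {poly K}) : beta u (a *: v) = a *: beta u v.
Proof.
have := linear_sumZ (linr u) [:: tt] (fun=> a) (fun=> v).
by rewrite !big_seq1.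
Qed.
Let betaDl (u u' v : {poly K}) : beta (u + u') v = beta u v + beta u' v.
Proof. by have := linl v 1 u u'; rewrite /= !scale1r. Qed.
Let betaDr (u v v' : {poly K}) : beta u (v + v') = beta u v + beta u v'.
Proof. by have := linr u 1 v v'; rewrite /= !scale1r. Qed.
Let betaNl (u v : {poly K}) : beta (- u) v = - beta u v.
Proof. by have := betaZl (-1) u v; rewrite !scaleN1r. Qed.
Let betaNr (u v : {poly K}) : beta u (- v) = - beta u v.
Proof. by have := betaZr (-1) u v; rewrite !scaleN1r. Qed.

Section Hankel.
Hypothesis balanced : forall u v : {poly K}, (size u <= n)%N -> (size v <= n)%N ->
  beta ('X * u) v = beta u ('X * v).

(* Any exponents [i, j <= n] with [i + j = l] would give the same moment; the
   first one is taken as large as possible. *)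
Let moment l := beta 'X^(minn l n) 'X^(l - minn l n).
Let functional (h : {poly K}) := \sum_(l < 2 * n + 1) h`_l *: moment l.

Let hankel i j : (i <= n)%N -> (j <= n)%N -> beta 'X^i 'X^j = moment (i + j).
Proof.
move=> li lj.
have shift d : (i + d <= n)%N -> (d <= j)%N ->
    beta 'X^i 'X^j = beta 'X^(i + d) 'X^(j - d).
  elim: d => [|d IH] led ldj; first by rewrite addn0 subn0.
  rewrite IH; [|lia|lia].
  have -> : (j - d = (j - d.+1).+1)%N by lia.
  rewrite addnS (exprS 'X (i + d)) (exprS 'X (j - d.+1)).
  by rewrite balanced ?size_polyXn //; lia.
rewrite /moment (shift (minn (i + j) n - i)%N); [|lia|lia].
by congr (beta 'X^_ 'X^_); lia.
Qed.

Let functional_linear : linear functional.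
Proof.
move=> a h h'; rewrite /functional scaler_sumr -big_split.
by apply: eq_bigr => l _; rewrite coefD coefZ scalerDl scalerA.
Qed.

Let functionalXn k : (k < 2 * n + 1)%N -> functional 'X^k = moment k.
Proof.
move=> lk; rewrite /functional (bigD1 (Ordinal lk)) //= coefXn eqxx scale1r.
rewrite big1 ?addr0 // => l; rewrite -val_eqE /= coefXn => /negPf->.
by rewrite scale0r.
Qed.

Let beta_functional (u v : {poly K}) :
  (size u <= n.+1)%N -> (size v <= n.+1)%N -> beta u v = functional (u * v).
Proof.
move=> su sv; rewrite [in LHS](sum_coefZ su) (linear_sumZ (linl v)).
rewrite [in RHS](sum_coefZ su) mulr_suml.
under [in RHS]eq_bigr do rewrite -scalerAl.
rewrite (linear_sumZ functional_linear); apply: eq_bigr => i _; congr (_ *: _).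
rewrite [in LHS](sum_coefZ sv) (linear_sumZ (linr _)).
rewrite [in RHS](sum_coefZ sv) mulr_sumr.
under [in RHS]eq_bigr do rewrite -scalerAr -exprD.
rewrite (linear_sumZ functional_linear); apply: eq_bigr => j _; congr (_ *: _).
rewrite functionalXn ?hankel ?leq_ord //.
by have := leq_ord i; have := leq_ord j; lia.
Qed.

(** A balanced form has a Hankel matrix in the monomial basis, so it depends only
on the product of its arguments; and by coprimality every product is a sum of
one with the factor [p] and one with the factor [q]. *)
Lemma balanced_eq0 (p q : {poly K}) :
  coprimep p q -> size p = n.+1 -> size q = n.+1 ->
  (forall u : {poly K}, (size u <= n.+1)%N -> beta p u = 0) ->
  (forall v : {poly K}, (size v <= n.+1)%N -> beta v q = 0) ->
  forall u v : {poly K}, (size u <= n.+1)%N -> (size v <= n.+1)%N -> beta u v = 0.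
Proof.
move=> cop sp sq pu vq u v su sv; rewrite beta_functional //.
have suv : (size (u * v)%R <= 2 * n + 1)%N.
  by rewrite (leq_trans (size_polyMleq _ _)) //; lia.
have [u' [v' [su' sv' ->]]] := coprimep_decomposition cop sp sq suv.
have := functional_linear 1 (p * u') (v' * q); rewrite !scale1r => ->.
by rewrite -!beta_functional ?sp ?sq // pu // vq // addr0.
Qed.

End Hankel.

Variables a b : nat -> K.
Hypotheses (a_inj : injective a) (b_inj : injective b).
Hypothesis ab : forall i j, a i != b j.

(** With [L] and [M] the Lagrange polynomials at [a_i] and [b_j], the splittings
[None] and [Some (i, j)], seen as polynomials in two variables, differ by
[(a_i - b_j) (X - Y) L(X) M(Y)]; such [L] and [M] form bases. *)
Lemma balanced_of_root_splits :
  (forall t : option ('I_n * 'I_n),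
     beta (root_split a b t).1 (root_split a b t).2 = 0) ->
  forall u v : {poly K}, (size u <= n)%N -> (size v <= n)%N ->
    beta ('X * u) v = beta u ('X * v).
Proof.
move=> split0 u v su sv.
have [c ->] := punctured_nodal_gen a_inj su.
have [d ->] := punctured_nodal_gen b_inj sv.
have mulX (e : 'I_n -> K) p :
    'X * (\sum_i e i *: p i) = \sum_i e i *: ('X * p i).
  by rewrite mulr_sumr; apply: eq_bigr => i _; rewrite -scalerAr.
rewrite !mulX !(linear_sumZ (linl _)); apply: eq_bigr => i _; congr (_ *: _).
rewrite !(linear_sumZ (linr _)); apply: eq_bigr => j _; congr (_ *: _).
have /= := split0 None; rewrite (nodalE a i) (nodalE b j).
have /= := split0 (Some (i, j)).
set L := punctured_nodal a i; set M := punctured_nodal b j.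
rewrite !mulrBl !mul_polyC !(betaDl, betaDr, betaNl, betaNr, betaZl, betaZr).
set A := beta ('X * L) ('X * M); set B := beta ('X * L) M.
set C := beta L ('X * M); set D := beta L M.
rewrite !opprK !scalerA [b j * a i]mulrC ![- _ + _ *: D]addrC.
rewrite addrACA -opprD => /subr0_eq e1.
rewrite addrACA -opprD => /subr0_eq e2.
have : (a i - b j) *: (B - C) = 0.
  rewrite scalerBl !scalerBr opprB addrACA -opprD -e1.
  by rewrite [_ *: C + _]addrC -e2 subrr.
move=> /eqP; rewrite scaler_eq0 subr_eq0 (negPf (ab _ _)) /= subr_eq0.
by move/eqP.
Qed.

End Balanced.

Lemma tens3_linear_l (K : fieldType) m1 m2 m3 (y : 'rV[K]_m2) (z : 'rV[K]_m3) :
  linear (fun x : 'rV[K]_m1 => tens3 x y z).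
Proof.
move=> c u u'; apply/matrixP => p k; case/mxvec_indexP: p => i j.
rewrite [RHS]mxE [X in _ = X + _]mxE !tens3E.
rewrite [X in X * _ * _]mxE [X in (X + _) * _ * _]mxE.
by rewrite !mulrDl !mulrA.
Qed.

Lemma tens3_linear_m (K : fieldType) m1 m2 m3 (x : 'rV[K]_m1) (z : 'rV[K]_m3) :
  linear (fun y : 'rV[K]_m2 => tens3 x y z).
Proof.
move=> c u u'; apply/matrixP => p k; case/mxvec_indexP: p => i j.
rewrite [RHS]mxE [X in _ = X + _]mxE !tens3E.
rewrite [X in _ * X * _]mxE [X in _ * (X + _) * _]mxE.
by rewrite mulrDr !mulrDl mulrCA !mulrA.
Qed.

(** The tensors [p (x) q (x) e_l], with [(p, q)] running through the splittings and
repetitions allowed, satisfy the tangent space criterion: a linear map [phi] that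
kills all tangent tensors gives, for each slice [s], a bilinear map on polynomials
that is balanced since it kills all splittings (from the tangent tensors
[x_l (x) y_l (x) e_s]), and that kills all pairs that share a factor with the
splitting attached to [s] (from the other tangent tensors), hence it is 0. *)
Lemma grank_pred_of_root_splits (K : fieldType) n m3 (a b : nat -> K) :
  injective a -> injective b -> (forall i j, a i != b j) ->
  (n ^ 2 + 1 <= m3)%N -> grank_pred K n.+1 n.+1 m3 m3.
Proof.
move=> a_inj b_inj ab le_m3; apply/asboolP; split; first by lia.
pose splits := enum {: option ('I_n * 'I_n)}.
pose split (l : 'I_m3) := root_split a b (nth None splits l).
have split_surj (t : option ('I_n * 'I_n)) :
    exists l, split l = root_split a b t.
  have lt : (index t splits < m3)%N.
    rewrite (leq_trans _ le_m3) // addn1 -mulnn.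
    have <- : size splits = (n * n).+1.
      by rewrite -cardE card_option card_prod !card_ord.
    by rewrite index_mem mem_enum.
  by exists (Ordinal lt); rewrite /split /= nth_index // mem_enum.
pose x (l : 'I_m3) : 'rV[K]_n.+1 * 'rV[K]_n.+1 * 'rV[K]_m3 :=
  (poly_rV (split l).1, poly_rV (split l).2, delta_mx 0 l).
exists x; set S := <<_>>%VS; apply/eqP; rewrite eqEsubv subvf /=.
(* A projection along [S]: its kernel is [S]. *)
pose phi T := T - projv S T.
have phi_lin : linear phi.
  by move=> c T T'; rewrite /phi linearP scalerBr opprD addrACA.
have phi0 T : T \in S -> phi T = 0 by move=> TS; rewrite /phi projv_id ?subrr.
apply/subvP => T _; suff : phi T = 0.
  by move/eqP; rewrite subr_eq0 => /eqP->; exact: memv_proj.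
pose beta (s : 'I_m3) (p q : {poly K}) :=
  phi (tens3 (poly_rV p) (poly_rV q) (delta_mx 0 s)).
have beta_linl s q : linear ((beta s)^~ q).
  by move=> c p p'; rewrite /beta linearP tens3_linear_l phi_lin.
have beta_linr s p : linear (beta s p).
  by move=> c q q'; rewrite /beta linearP tens3_linear_m phi_lin.
have in1 s l : tens3 (x l).1.1 (x l).1.2 (delta_mx 0 s) \in S.
  apply: memv_span; rewrite !mem_cat; apply/orP; right; apply/orP; right.
  by apply/allpairsP; exists (l, s); rewrite !mem_enum.
have in2 s i : tens3 (x s).1.1 (delta_mx 0 i) (delta_mx 0 s) \in S.
  apply: memv_span; rewrite !mem_cat; apply/orP; right; apply/orP; left.
  by apply/allpairsP; exists (s, i); rewrite !mem_enum.
have in3 s i : tens3 (delta_mx 0 i) (x s).1.2 (delta_mx 0 s) \in S.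
  apply: memv_span; rewrite !mem_cat; apply/orP; left.
  by apply/allpairsP; exists (s, i); rewrite !mem_enum.
have beta0 s (p q : {poly K}) :
    (size p <= n.+1)%N -> (size q <= n.+1)%N -> beta s p q = 0.
  have [sp sq] := @size_root_split K n a b (nth None splits s).
  apply: (@balanced_eq0 _ _ n _ (beta_linl s) (beta_linr s) _
            (split s).1 (split s).2) => //.
  - apply: (balanced_of_root_splits (beta_linl s) (beta_linr s)
              a_inj b_inj ab) => t.
    by have [l <-] := split_surj t; exact/phi0/(in1 s l).
  - exact: coprime_root_split.
  - move=> u _; rewrite /beta [poly_rV u]row_sum_delta.
    rewrite (linear_sumZ (tens3_linear_m _ _)) (linear_sumZ phi_lin) big1 // => i _.
    by rewrite phi0 ?scaler0 //; exact: in2.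
  - move=> u _; rewrite /beta [poly_rV u]row_sum_delta.
    rewrite (linear_sumZ (tens3_linear_l _ _)) (linear_sumZ phi_lin) big1 // => i _.
    by rewrite phi0 ?scaler0 //; exact: in3.
rewrite (tensor_sum_delta T).
under eq_bigr do rewrite -[X in tens3 X _ _]rVpolyK
  -[X in tens3 _ X _]rVpolyK -[tens3 _ _ _]scale1r.
rewrite (linear_sumZ phi_lin) big1 // => -[[i j] s] _ /=.
by rewrite [X in _ *: X](beta0 s) ?scaler0 // size_poly.
Qed.

(** * Comparison of the two ranks *)

(** Even and odd numbers serve as the two families of roots. *)
Lemma grank_le (K : numFieldType) n m3 :
  (n ^ 2 + 1 <= m3)%N -> (grank K n.+1 n.+1 m3 <= m3)%N.
Proof.
move=> le_m3; rewrite /grank; case: ex_minnP => k _; apply.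
apply: (@grank_pred_of_root_splits K n m3
          (fun k => (k.*2)%:R) (fun k => (k.*2.+1)%:R)) => // [i j|i j|i j].
- by move/eqP; rewrite eqr_nat => /eqP/double_inj.
- by move/eqP; rewrite eqr_nat => /eqP[]/double_inj.
- by rewrite eqr_nat; apply/eqP; lia.
Qed.

Lemma mtrank_gt (R : realType) m1 m2 m3 n (b : 'I_n -> 'M[R]_(m1.+1, m2.+1)) :
  nonsingular b -> (0 < m3)%N -> (m3 + n <= m1.+1 * m2.+1)%N ->
  (m3 < mtrank R m1.+1 m2.+1 m3)%N.
Proof.
move=> nsb m30 le_n; rewrite /mtrank; case: ex_minnP => k rank_k _.
by rewrite ltnNge; apply/negP => /(not_mtrank_of_nonsingular nsb m30 le_n).
Qed.

Local Close Scope ring_scope.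
Local Close Scope classical_set_scope.

Theorem theorem7p4 (R : realType) :
  (forall m m3 : nat, 2 <= m -> m3 = (m - 1) ^ 2 + 1 ->
     mtrank R m m m3 > grank R[i] m m m3) /\
  (forall m3 : nat, m3 = 11 \/ m3 = 12 ->
     mtrank R 4 4 m3 > grank R[i] 4 4 m3).
Proof.
split=> [[//|n] m3 m2 m3E|m3 m3E].
  rewrite subn1 /= in m3E.
  (* Equality holds in the dimension bound: (n^2 + 1) + 2n = (n + 1)^2. *)
  have ns := @skew_forms_nonsingular R _ m2.
  apply: (@leq_ltn_trans m3); first by apply: grank_le; rewrite m3E.
  by apply: (mtrank_gt ns); rewrite m3E -?mulnn; lia.
apply: (@leq_ltn_trans m3); first by apply: grank_le; lia.
by apply: (mtrank_gt (@quaternion_forms_nonsingular R)); lia.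
Qed.
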